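(* For all integers $n\ge 1$ and $s\ge 2$, $\chi_{ltna}(C_{4n+2}\vee W_{2s})=5$.
   Context: All graphs are finite and simple. $C_k$ is the cycle on $k$ vertices. $W_{2s}$ is the wheel of order $2s+1$: $V(W_{2s})=\{v_j\mid 1\le j\le 2s+1\}$ and $E(W_{2s})=\{v_1v_{2s}\}\cup\{v_jv_{j+1}\mid 1\le j\le 2s-1\}\cup\{v_jv_{2s+1}\mid 1\le j\le 2s\}$. The join $G\vee H$ of (vertex-disjoint) graphs has $V(G\vee H)=V(G)\cup V(H)$ and $E(G\vee H)=E(G)\cup E(H)\cup\{uv\mid u\in V(G),v\in V(H)\}$. For a graph $G=(V,E)$ of order $p$ and size $q$ without isolated vertices, a bijection $f:V\cup E\to\{1,\dots,p+q\}$ is a local total neighborhood antimagic labeling of $G$ if the induced vertex coloring $f^+_{tn}(u)=\sum_{ux\in E}[f(ux)+f(x)]$ satisfies $f^+_{tn}(u)\ne f^+_{tn}(v)$ for every edge $uv\in E$. The number of distinct induced colors is $c_{tn}(f)$. The local total neighborhood antimagic chromatic number $\chi_{ltna}(G)$ is the minimum of $c_{tn}(f)$ over all local total neighborhood antimagic labelings $f$ of $G$; an assertion $\chi_{ltna}(G)=k$ includes the assertion that $G$ admits such a labeling. *)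

(* Defs.v *)
From mathcomp Require Import all_boot.

Set Implicit Arguments.
Unset Strict Implicit.
Unset Printing Implicit Defensive.

Record sgraph := SGraph {
  svertex :> finType;
  sadj : rel svertex;
  sadj_sym : symmetric sadj;
  sadj_irr : irreflexive sadj }.

Definition edges (G : sgraph) : {set {set G}} :=
  [set [set uv.1; uv.2] | uv in [pred uv : G * G | sadj uv.1 uv.2]].

Definition no_isolated (G : sgraph) : Prop :=
  forall u : G, exists v : G, sadj u v.

(* The simple graph whose edges are listed, in some orientation, by [r].
   Loops are discarded. *)
Definition simple_adj (T : finType) (r : rel T) : rel T :=
  fun x y => (x != y) && (r x y || r y x).

Lemma simple_adj_sym (T : finType) (r : rel T) : symmetric (simple_adj r).
Proof. by move=> x y; rewrite /simple_adj eq_sym orbC. Qed.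

Lemma simple_adj_irr (T : finType) (r : rel T) : irreflexive (simple_adj r).
Proof. by move=> x; rewrite /simple_adj eqxx. Qed.

Definition simple_graph (T : finType) (r : rel T) : sgraph :=
  SGraph (simple_adj_sym r) (simple_adj_irr r).

(* The cycle on [k] vertices; meaningful for [2 < k]. *)
Definition cycle_graph (k : nat) : sgraph :=
  simple_graph (fun i j : 'I_k => j == i.+1 %% k :> nat).

(* The wheel of order [m + 1]; meaningful for [2 < m]. The ordinal [i] stands
   for v_(i+1), so the rim is 0, ..., m - 1 and the hub is [m]. *)
Definition wheel_graph (m : nat) : sgraph :=
  simple_graph (fun i j : 'I_m.+1 =>
    [|| (i == 0 :> nat) && (j == m.-1 :> nat),
        (j == i.+1 :> nat) && (j < m)
      | (i < m) && (j == m :> nat)]).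

Section Join.
Variables G H : sgraph.

Definition join_adj : rel (G + H)%type := fun x y =>
  match x, y with
  | inl u, inl v => sadj u v
  | inr u, inr v => sadj u v
  | _, _ => true
  end.

Lemma join_adj_sym : symmetric join_adj.
Proof. by move=> [x|x] [y|y] //=; apply: sadj_sym. Qed.

Lemma join_adj_irr : irreflexive join_adj.
Proof. by move=> [x|x] /=; apply: sadj_irr. Qed.

Definition join_graph : sgraph := SGraph join_adj_sym join_adj_irr.
End Join.

Section Labeling.
Variable G : sgraph.

(* V + E, as a subset of [G + {set G}]. Labelings are total functions on
   [G + {set G}], but only their values on [elements] ever matter. *)
Definition elements : {set (G + {set G})%type} :=
  [set z | match z with inl _ => true | inr e => e \in edges G end].

Definition is_total_labeling (f : G + {set G} -> nat) : Prop :=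
  {in elements &, injective f} /\
  (forall k : nat, (exists2 z, z \in elements & f z = k) <->
                   1 <= k <= #|G| + #|edges G|).

Definition tn_color (f : G + {set G} -> nat) (u : G) : nat :=
  \sum_(x : G | sadj u x) (f (inr [set u; x]) + f (inl x)).

Definition is_ltna_labeling (f : G + {set G} -> nat) : Prop :=
  is_total_labeling f /\
  (forall u v : G, sadj u v -> tn_color f u != tn_color f v).

Definition c_tn (f : G + {set G} -> nat) : nat :=
  size (undup [seq tn_color f u | u : G]).

(* [chi_ltna_is k] says that the local total neighborhood antimagic chromatic
   number of [G] is defined and equal to [k]. *)
Definition chi_ltna_is (k : nat) : Prop :=
  [/\ no_isolated G,
      exists2 f, is_ltna_labeling f & c_tn f = k
    & forall f, is_ltna_labeling f -> k <= c_tn f].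
End Labeling.

(* Main.v *)
(** The lower bound holds because the join contains a K_5, on whose vertices all
    colors differ.

    For the upper bound put [h := 2n+1] and write [u_i] for the [2h] cycle
    vertices and [v_j] for the [2s] rim vertices.  The labels of the edges
    [u_i v_j] form a [2h x 2s] array in which the entries of columns [2t] and
    [2t+1] are paired off with constant sum inside each row; so the row sums are
    constant, and the low and high entries alternate down a column, so that the
    column sum depends on the parity of the column only.  In the odd columns
    the entries of row 0 are shifted cyclically by one, which perturbs the sum
    of column [2t+1] by [t - (t+1 mod s)].

    What remains is to label, on each of the two even cycles, the vertices, the
    edges and the spokes to the hub so that two neighboring edges, two
    neighboring vertices and the spoke have a sum depending on the parity of
    the position only.  Vertices and edges get piecewise linear labels; their
    sums are linear in the position with slope 2, except for jumps where the
    cycle closes up.  The jumps cancel each other: on the [u]-cycle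
    because [h] is odd (the edges use [i mod h], with alternating signs), on the
    rim because of the perturbed column sums.  Spoke labels of slope -2 then
    make the sums constant. *)

Require Import Defs.
From mathcomp Require Import all_boot zify.

Set Implicit Arguments.
Unset Strict Implicit.
Unset Printing Implicit Defensive.

(** * Color counts, and labelings built from an enumeration of the edges *)

Lemma clique_c_tn (G : sgraph) (f : G + {set G} -> nat) (q : seq G) :
  is_ltna_labeling f -> pairwise (@sadj G) q -> size q <= c_tn f.
Proof.
move=> [_ f_proper] q_clique; rewrite -(size_map (tn_color f)) /c_tn.
apply: uniq_leq_size => [|c].
  rewrite uniq_pairwise pairwise_map; apply: sub_pairwise q_clique => u v.
  exact: f_proper.
by move=> /mapP[u _ ->]; rewrite mem_undup map_f // mem_enum.
Qed.

Lemma c_tn_le (G : sgraph) (f : G + {set G} -> nat) (q : seq nat) :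
  (forall u, tn_color f u \in q) -> c_tn f <= size q.
Proof.
move=> f_q; apply: uniq_leq_size; first exact: undup_uniq.
by move=> c; rewrite mem_undup => /mapP[u _ ->].
Qed.

Lemma set2_inj (T : finType) (a b c d : T) :
  [set a; b] = [set c; d] -> (a = c /\ b = d) \/ (a = d /\ b = c).
Proof.
move=> E; have := set21 a b; have := set22 a b; rewrite E.
rewrite !in_set2 => /orP[] /eqP Eb /orP[] /eqP Ea; subst; try by [left|right].
  by have := set22 c d; rewrite -E in_set2 orbb => /eqP; left.
by have := set21 c d; rewrite -E in_set2 orbb => /eqP; left.
Qed.

(** Lets the construction work with ordered ends and an index type [J] instead of sets of vertices.
    Injectivity of [lab] also forces distinct indices to name distinct edges, so [J] counts the
    edges, and an injection into an interval of the same size is onto. *)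
Lemma total_labeling_of_ends (G : sgraph) (J : finType) (ends : J -> G * G)
    (g : G -> nat) (l : G -> G -> nat)
    (lab := fun z : G + J =>
       match z with inl u => g u | inr j => l (ends j).1 (ends j).2 end) :
  (forall u v, l u v = l v u) ->
  (forall j, sadj (ends j).1 (ends j).2) ->
  (forall u v, sadj u v ->
     exists j, [set u; v] = [set (ends j).1; (ends j).2]) ->
  injective lab -> (forall z, 1 <= lab z <= #|G| + #|J|) ->
  exists f : G + {set G} -> nat, [/\ is_total_labeling f,
    forall u, f (inl u) = g u & forall u v, f (inr [set u; v]) = l u v].
Proof.
move=> l_sym ends_adj ends_surj lab_inj lab_bd.
pose f (z : G + {set G}) := match z with
  | inl u => g u
  (* The order in which the ends are picked is immaterial since [l] is symmetric; 0 is a default for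
     sets that are not of the form [[set x; y]]. *)
  | inr e => if [pick p | e == [set p.1; p.2]] is Some p then l p.1 p.2 else 0
  end.
have f_edge u v : f (inr [set u; v]) = l u v.
  rewrite /f; case: pickP => [[x y] /= /eqP /set2_inj[[-> ->]|[-> ->]] //|].
  by move/(_ (u, v)); rewrite eqxx.
pose emb (z : G + J) : G + {set G} := match z with
  | inl u => inl u | inr j => inr [set (ends j).1; (ends j).2] end.
have f_emb z : f (emb z) = lab z by case: z => [u|j] //=; exact: f_edge.
have emb_inj : injective emb.
  by move=> y z E; apply: lab_inj; rewrite -!f_emb E.
have elemP z : reflect (exists y, z = emb y) (z \in elements G).
  apply: (iffP idP) => [|[y ->]].
    case: z => [u _|e]; first by exists (inl u).
    rewrite inE => /imsetP[[u v] /= uv ->].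
    by have [j ->] := ends_surj _ _ uv; exists (inr j).
  case: y => [u|j]; rewrite inE //=.
  by apply/imsetP; exists (ends j) => //; rewrite inE.
have card_edges : #|edges G| = #|J|.
  have <- : [set [set (ends j).1; (ends j).2] | j : J] = edges G.
    apply/setP=> e; apply/imsetP/imsetP => [[j _ ->]|[[u v] uv ->]].
      by exists (ends j) => //; apply: ends_adj.
    by have [j ->] := ends_surj _ _ uv; exists j.
  apply: card_imset => j j' E.
  by have [] : inr j = inr j' :> G + J by apply: emb_inj; rewrite /= E.
exists f; split=> //; split.
  by move=> y z /elemP[y' ->] /elemP[z' ->]; rewrite !f_emb => /lab_inj->.
move=> k; rewrite card_edges; split=> [[z /elemP[y ->]] <-|k_bd].
  by rewrite f_emb.
(* Surjectivity by counting: labels shifted down by one map [G + J] injectively into an ordinal of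
   its own cardinality. *)
have lab_lt z : (lab z).-1 < #|{: G + J}|.
  by have := lab_bd z; rewrite card_sum; lia.
pose pos z := Ordinal (lab_lt z).
have pos_inj : injective pos.
  move=> y z [E]; apply: lab_inj; move: E (lab_bd y) (lab_bd z); lia.
have [inv _ posK] : bijective pos by apply: inj_card_bij; rewrite ?card_ord.
have k_lt : k.-1 < #|{: G + J}| by rewrite card_sum; lia.
exists (emb (inv (Ordinal k_lt))); first by apply/elemP; eexists.
have [] := posK (Ordinal k_lt); rewrite f_emb.
have := lab_bd (inv (Ordinal k_lt)); lia.
Qed.

(** * Sums over initial segments of the naturals *)

Lemma sum_ord_mem (N : nat) (r : seq nat) (P : pred nat) (F : nat -> nat) :
  uniq r -> all (fun y => y < N) r -> (forall x, x < N -> P x = (x \in r)) ->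
  \sum_(x < N | P x) F x = \sum_(y <- r) F y.
Proof.
move=> r_uniq /allP r_lt P_r; rewrite -(big_mkord P F) -big_filter.
apply: perm_big; apply: uniq_perm => //; first exact/filter_uniq/iota_uniq.
move=> y; rewrite mem_filter mem_index_iota /=.
by case: (ltnP y N) => [/P_r -> | yN]; rewrite ?andbT ?andbF //;
   apply/esym/negP => /r_lt; rewrite ltnNge yN.
Qed.

Lemma sum_ord_double (N : nat) (F : nat -> nat) :
  \sum_(i < 2 * N) F i = \sum_(t < N) (F (2 * t) + F (2 * t + 1)).
Proof.
elim: N => [|N IHN]; first by rewrite !big_ord0.
by rewrite [RHS]big_ord_recr /= -IHN mulnS add2n !big_ord_recr /= addn1 addnA.
Qed.

Lemma sum_ord_inj (N : nat) (p : nat -> nat) :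
  (forall i, i < N -> p i < N) ->
  (forall i j, i < N -> j < N -> p i = p j -> i = j) ->
  \sum_(i < N) p i = \sum_(i < N) i.
Proof.
move=> p_lt p_inj.
pose q (i : 'I_N) := Ordinal (p_lt i (ltn_ord i)).
have q_inj : injective q.
  by move=> i j [] /p_inj E; apply/val_inj/E.
by rewrite [RHS](reindex_inj q_inj).
Qed.

Lemma sum_ord_even (N : nat) : \sum_(i < 2 * N) i = N * (2 * N - 1).
Proof.
elim: N => [|N IHN]; first by rewrite big_ord0.
by rewrite mulnS add2n !big_ord_recr /= IHN; nia.
Qed.

(** * Cyclic neighbors and adjacency in cycles and wheels *)

Definition cnext (k i : nat) := if i.+1 == k then 0 else i.+1.
Definition cprev (k i : nat) := if i == 0 then k.-1 else i.-1.

Lemma cnext_lt (k i : nat) : i < k -> cnext k i < k.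
Proof. by rewrite /cnext; case: eqP; lia. Qed.

Lemma cprev_lt (k i : nat) : i < k -> cprev k i < k.
Proof. by rewrite /cprev; case: eqP; lia. Qed.

Lemma cprevK (k i : nat) : i < k -> cnext k (cprev k i) = i.
Proof. by rewrite /cnext /cprev; do 2!case: ifP; lia. Qed.

Lemma cnext_inj (k i j : nat) :
  i < k -> j < k -> cnext k i = cnext k j -> i = j.
Proof. by rewrite /cnext; do 2!case: ifP; lia. Qed.

Lemma modn_cnext (k i : nat) : i < k -> i.+1 %% k = cnext k i.
Proof.
rewrite /cnext; case: eqP => [-> _ | ne lt]; first exact: modnn.
by apply: modn_small; lia.
Qed.

Lemma cycle_adjE (k : nat) (i j : 'I_k) : 2 < k ->
  sadj (s := cycle_graph k) i j = ((j : nat) \in [:: cnext k i; cprev k i]).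
Proof.
move=> k_gt2; rewrite /= /simple_adj /= !modn_cnext // !inE -val_eqE /=.
have := ltn_ord i; have := ltn_ord j; rewrite /cnext /cprev.
by do 3!case: ifP; lia.
Qed.

Lemma rim_adjE (k : nat) (i j : 'I_k.+1) : 2 < k -> i < k ->
  sadj (s := wheel_graph k) i j =
  ((j : nat) \in [:: k; cnext k i; cprev k i]).
Proof.
move=> k_gt2 i_lt; rewrite /= /simple_adj /= !inE -val_eqE /=.
have := ltn_ord j; rewrite /cnext /cprev.
by do 2!case: ifP; lia.
Qed.

Lemma hub_adjE (k : nat) (j : 'I_k.+1) :
  sadj (s := wheel_graph k) ord_max j = (j < k).
Proof.
rewrite /= /simple_adj /= -val_eqE /=; have := ltn_ord j; lia.
Qed.

Lemma half_even t : (2 * t)./2 = t. Proof. lia. Qed.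
Lemma half_odd t : (2 * t + 1)./2 = t. Proof. lia. Qed.
Lemma odd_even t : odd (2 * t) = false. Proof. lia. Qed.
Lemma odd_odd t : odd (2 * t + 1) = true. Proof. lia. Qed.

Lemma cnext_even k t : t < k -> cnext (2 * k) (2 * t) = 2 * t + 1.
Proof. by rewrite /cnext; case: ifP; lia. Qed.

Lemma cnext_odd k t : t < k -> cnext (2 * k) (2 * t + 1) = 2 * cnext k t.
Proof. by rewrite /cnext; do 2!case: ifP; lia. Qed.

Lemma cprev_even k t : t < k -> cprev (2 * k) (2 * t) = 2 * cprev k t + 1.
Proof. by rewrite /cprev; do 2!case: ifP; lia. Qed.

Lemma cprev_odd k t : cprev (2 * k) (2 * t + 1) = 2 * t.
Proof. by rewrite /cprev; case: ifP; lia. Qed.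

Definition double_cycle := (cnext_even, cnext_odd, cprev_even, cprev_odd).
Definition parity := (half_even, half_odd, odd_even, odd_odd).

(* [fu], [cu], [du] label the vertices of the cycle, its edges (the edge from [i]
   to [i+1] has label [cu i]) and its edges to the hub; [fv], [cv], [dv] do the
   same for the rim, and [join_lab] labels the edges from cycle to rim. *)
Section JoinLabels.
Variables (m k : nat) (fu cu du fv cv dv : nat -> nat) (hub : nat).
Variable join_lab : nat -> nat -> nat.
Hypotheses (m_gt2 : 2 < m) (k_gt2 : 2 < k).

Let G := join_graph (cycle_graph m) (wheel_graph k).

(** * Labels, edge enumeration and colors for the join *)

Definition vlab (x : G) : nat :=
  match x with inl i => fu i | inr j => if j < k then fv j else hub end.

(** An edge carries the label of the end whose successor is the other end. For [2 < p] at most one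
    of the tests succeeds, whence the symmetry; 0 is the value off the cycle. *)
Definition cycle_lab (p : nat) (c : nat -> nat) (i j : nat) : nat :=
  if j == cnext p i then c i else if i == cnext p j then c j else 0.

Definition rung_lab (i j : nat) : nat := if j < k then join_lab i j else du i.

Definition elab (x y : G) : nat :=
  match x, y with
  | inl i, inl j => cycle_lab m cu i j
  | inl i, inr j => rung_lab i j
  | inr j, inl i => rung_lab i j
  | inr i, inr j => if j == k :> nat then dv i else
                    if i == k :> nat then dv j else cycle_lab k cv i j
  end.

Lemma cycle_lab_next p c i : cycle_lab p c i (cnext p i) = c i.
Proof. by rewrite /cycle_lab eqxx. Qed.

Lemma cycle_lab_sym p c i j : 2 < p ->
  cycle_lab p c i j = cycle_lab p c j i.
Proof.
move=> p_gt2; rewrite /cycle_lab /cnext.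
by do !case: ifP; lia.
Qed.

Lemma cycle_lab_prev p c i : 2 < p -> i < p ->
  cycle_lab p c i (cprev p i) = c (cprev p i).
Proof. by move=> p2 ip; rewrite cycle_lab_sym // -{2}(cprevK ip) cycle_lab_next. Qed.

Lemma elab_sym x y : elab x y = elab y x.
Proof.
case: x y => [i|i] [j|j] //=; first exact: cycle_lab_sym.
rewrite cycle_lab_sym //; case: eqP => [jk|]; case: eqP => // ik.
by rewrite ik jk.
Qed.

(** In order: edges between cycle and wheel (column [k] being the hub), cycle edges, rim edges,
    rim-to-hub spokes. A cycle or rim edge is indexed by the end that precedes the other. *)
Definition edge_index : finType := ('I_m * 'I_k.+1 + ('I_m + ('I_k + 'I_k)))%type.

Definition ends (e : edge_index) : G * G :=
  match e with
  | inl (i, j) => (inl i, inr j)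
  | inr (inl i) => (inl i, inl (Ordinal (cnext_lt (ltn_ord i))))
  | inr (inr (inl j)) => (inr (inord j), inr (inord (cnext k j)))
  | inr (inr (inr j)) => (inr (inord j), inr ord_max)
  end.

Lemma ends_adj e : sadj (ends e).1 (ends e).2.
Proof.
case: e => [[i j]|[i|[j|j]]] //.
- suff: sadj (s := cycle_graph m) i (Ordinal (cnext_lt (ltn_ord i))) by [].
  by rewrite cycle_adjE // !inE eqxx.
- have jk := ltn_ord j; have nk := cnext_lt jk.
  suff: sadj (s := wheel_graph k) (inord j) (inord (cnext k j)) by [].
  by rewrite rim_adjE // !inordK ?inE ?eqxx ?orbT // ltnS ltnW.
- have jk := ltn_ord j.
  suff: sadj (s := wheel_graph k) (inord j) ord_max by [].
  by rewrite rim_adjE // ?inordK ?inE ?eqxx // ltnS ltnW.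
Qed.

Lemma ends_surj x y : sadj x y ->
  exists e, [set x; y] = [set (ends e).1; (ends e).2].
Proof.
have set2C (a b : G) : [set a; b] = [set b; a] by rewrite setUC.
have rim_surj (i j : 'I_k.+1) : i < k ->
    sadj (s := wheel_graph k) i j -> exists e : edge_index,
    [set inr i; inr j : G] = [set (ends e).1; (ends e).2].
  move=> i_lt; have iE : inord i = i by exact: inord_val.
  rewrite rim_adjE // !inE => /or3P[] /eqP jE.
  - exists (inr (inr (inr (Ordinal i_lt)))); rewrite /= iE.
    by congr [set _; inr _]; apply: val_inj.
  - exists (inr (inr (inl (Ordinal i_lt)))); rewrite /= iE.
    by congr [set _; inr _]; apply: val_inj; rewrite /= inordK // -jE.
  - exists (inr (inr (inl (Ordinal (cprev_lt i_lt))))).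
    by rewrite set2C /= cprevK // iE -jE inord_val.
case: x y => [i|i] [j|j] //=; last first.
- move=> ij; case: (ltnP i k) => [i_lt|i_ge]; first exact: rim_surj.
  (* An end outside the rim is the hub; its neighbor then lies on the rim, so the ends can be
     swapped. *)
  have iE : i = ord_max by apply: val_inj; have := ltn_ord i; rewrite /=; lia.
  move: ij; rewrite iE => ij; rewrite set2C; apply: rim_surj.
    by rewrite -hub_adjE.
  by rewrite sadj_sym.
- by exists (inl (j, i)); rewrite set2C.
- by exists (inl (i, j)).
move=> ij; have {ij} : sadj (s := cycle_graph m) i j by [].
rewrite cycle_adjE // !inE => /orP[] /eqP jE.
- exists (inr (inl i)); congr [set _; inl _]; exact: val_inj.
- exists (inr (inl j)); rewrite set2C; congr [set _; inl _].
  by apply: val_inj; rewrite /= jE cprevK.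
Qed.

Lemma sum_cycle_nbrs (i : 'I_m) (F : nat -> nat) :
  \sum_(x : 'I_m | sadj (s := cycle_graph m) i x) F x =
  F (cnext m i) + F (cprev m i).
Proof.
have im := ltn_ord i.
rewrite (eq_bigl (fun x : 'I_m => (x : nat) \in [:: cnext m i; cprev m i])).
  rewrite (@sum_ord_mem _ [:: cnext m i; cprev m i]) ?big_cons ?big_nil ?addn0 //=.
    by rewrite inE andbT /cnext /cprev; do 2!case: ifP; lia.
  by rewrite cnext_lt ?cprev_lt.
by move=> x; rewrite cycle_adjE.
Qed.

Lemma sum_rim_nbrs (i : 'I_k.+1) (F : nat -> nat) : i < k ->
  \sum_(x : 'I_k.+1 | sadj (s := wheel_graph k) i x) F x =
  F k + F (cnext k i) + F (cprev k i).
Proof.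
move=> ik; rewrite (eq_bigl (fun x : 'I_k.+1 =>
  (x : nat) \in [:: k; cnext k i; cprev k i])).
  rewrite (@sum_ord_mem _ [:: k; cnext k i; cprev k i]) ?big_cons ?big_nil
    ?addn0 ?addnA //=.
    by rewrite !inE andbT /cnext /cprev; do 2!case: ifP; lia.
  by have := cnext_lt ik; have := cprev_lt ik; lia.
by move=> x; rewrite rim_adjE.
Qed.

Lemma sum_hub_nbrs (F : nat -> nat) :
  \sum_(x : 'I_k.+1 | sadj (s := wheel_graph k) ord_max x) F x = \sum_(x < k) F x.
Proof.
rewrite (eq_bigl (fun x : 'I_k.+1 => x < k)) => [|x]; last exact: hub_adjE.
rewrite big_mkcond big_ord_recr /= ltnn addn0.
by apply: eq_bigr => x _; rewrite ltn_ord.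
Qed.

Variable f : G + {set G} -> nat.
Hypotheses (f_vert : forall x, f (inl x) = vlab x)
           (f_edge : forall x y, f (inr [set x; y]) = elab x y).

Lemma tn_color_split (x : G) : tn_color f x =
  \sum_(i : 'I_m | sadj x (inl i)) (elab x (inl i) + vlab (inl i)) +
  \sum_(j : 'I_k.+1 | sadj x (inr j)) (elab x (inr j) + vlab (inr j)).
Proof.
transitivity (\sum_(y : G | sadj x y) (elab x y + vlab y)).
  by apply: eq_bigr => y _; rewrite f_vert f_edge.
exact: big_sumType.
Qed.

Lemma tn_color_cycle (i : 'I_m) : tn_color f (inl i) =
  cu i + cu (cprev m i) + (fu (cnext m i) + fu (cprev m i)) + du i
  + \sum_(j < k) join_lab i j + \sum_(j < k) fv j + hub.
Proof.
rewrite tn_color_split.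
rewrite [X in X + _](sum_cycle_nbrs i (fun x => cycle_lab m cu i x + fu x)).
rewrite big_ord_recr /= /rung_lab ltnn cycle_lab_next cycle_lab_prev //.
under eq_bigr => j _ do rewrite /= ltn_ord.
by rewrite big_split /=; lia.
Qed.

Lemma tn_color_rim (j : 'I_k.+1) : j < k -> tn_color f (inr j) =
  cv j + cv (cprev k j) + (fv (cnext k j) + fv (cprev k j)) + dv j
  + \sum_(i < m) join_lab i j + \sum_(i < m) fu i + hub.
Proof.
move=> jk; have nk := cnext_lt jk; have pk := cprev_lt jk.
rewrite tn_color_split.
rewrite [X in _ + X](sum_rim_nbrs (fun x => (if x == k then dv j else
  if j == k :> nat then dv x else cycle_lab k cv j x) +
  if x < k then fv x else hub) jk).
rewrite eqxx ltnn !ltn_eqF // nk pk cycle_lab_next cycle_lab_prev //=.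
rewrite /rung_lab jk big_split /=; lia.
Qed.

Lemma tn_color_hub : tn_color f (inr ord_max) =
  \sum_(i < m) (du i + fu i) + \sum_(j < k) (dv j + fv j).
Proof.
rewrite tn_color_split; congr (_ + _).
  by apply: eq_bigr => i _; rewrite /= /rung_lab ltnn.
rewrite [LHS](sum_hub_nbrs (fun x => (if x == k then dv k else
  if k == k then dv x else cycle_lab k cv k x) + if x < k then fv x else hub)).
by apply: eq_bigr => j _; rewrite ltn_ord eqxx ltn_eqF.
Qed.

End JoinLabels.

Section Construction.
Variables (n s : nat).
Hypotheses (n_gt0 : 0 < n) (s_gt1 : 1 < s).

(** * Positions of the labels inside their blocks *)

Notation h := (2 * n + 1).

(** Rotation by [n] modulo [h]. It wraps between [n] and [n + 1], that is, around position [h] of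
    the cycle, where the residues used by [cu_pos] wrap as well. *)
Definition turn (t : nat) := if t + n < h then t + n else t + n - h.

Definition fu_pos i := if odd i then h + i./2 else turn i./2.
(** Here [r] is [i] mod [h]. As [h] is odd, [i] and [i + h] have opposite parities, so each residue
    occurs once at an even and once at an odd position. *)
Definition cu_pos i :=
  let r := if i < h then i else i - h in if odd i then 2 * h - 1 - r else r.
Definition du_pos i :=
  if odd i then 2 * (h - 1 - turn i./2) + 1 else 2 * (h - 1 - i./2).
Definition fv_pos j := if odd j then s + j./2 else j./2.
Definition cv_pos j := if odd j then 2 * s - 1 - j./2 else j./2.
Definition dv_pos j := 2 * (s - 1 - j./2) + odd j.

Definition twist i t := if i == 0 then cnext s t else t.

Definition join_idx i j := if odd j then twist i j./2 else j./2.

Definition join_pos i j :=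
  let z := i * s + join_idx i j in
  if odd i == odd j then z else 4 * h * s - 1 - z.

Lemma turn_lt t : t < h -> turn t < h.
Proof. by rewrite /turn; case: ifP; lia. Qed.

Lemma turn_inj t t' : t < h -> t' < h -> turn t = turn t' -> t = t'.
Proof. by rewrite /turn; do 2!case: ifP; lia. Qed.

Lemma twist_lt i t : t < s -> twist i t < s.
Proof. by rewrite /twist; case: ifP => // _; apply: cnext_lt. Qed.

Lemma twist_inj i t t' : t < s -> t' < s -> twist i t = twist i t' -> t = t'.
Proof. by rewrite /twist; case: ifP => // _; apply: cnext_inj. Qed.

Lemma join_idx_lt i j : j < 2 * s -> join_idx i j < s.
Proof.
rewrite /join_idx => j_lt; case: ifP => _; [apply: twist_lt|]; lia.
Qed.

Lemma join_idx_inj i j j' : j < 2 * s -> j' < 2 * s ->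
  odd j = odd j' -> join_idx i j = join_idx i j' -> j = j'.
Proof.
rewrite /join_idx => j_lt j'_lt odd_jj' E.
suff : j./2 = j'./2 by lia.
move: E; rewrite odd_jj'; case: ifP => _ //.
by apply: twist_inj; lia.
Qed.

Lemma join_low_lt i j : i < 2 * h -> j < 2 * s ->
  i * s + join_idx i j < 2 * h * s.
Proof. by move=> i_lt /(join_idx_lt i); nia. Qed.

Lemma join_pos_lt i j : i < 2 * h -> j < 2 * s -> join_pos i j < 4 * h * s.
Proof.
move=> i_lt j_lt; have := join_low_lt i_lt j_lt.
rewrite /join_pos /=; case: ifP => _; lia.
Qed.

(** Low entries lie below [2 * h * s] and high ones do not, so the value reveals whether the
    parities agree and the underlying number. Division of that number by [s] gives the row and the
    index, and the row fixes the parity of the column. *)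
Lemma join_pos_inj i j i' j' : i < 2 * h -> j < 2 * s ->
  i' < 2 * h -> j' < 2 * s -> join_pos i j = join_pos i' j' ->
  i = i' /\ j = j'.
Proof.
move=> i_lt j_lt i'_lt j'_lt E.
have lt := join_low_lt i_lt j_lt; have lt' := join_low_lt i'_lt j'_lt.
have [same E2] : (odd i == odd j) = (odd i' == odd j') /\
    i * s + join_idx i j = i' * s + join_idx i' j'.
  by move: E; rewrite /join_pos /=; do 2!case: ifP => _; lia.
have := join_idx_lt i j_lt; have := join_idx_lt i' j'_lt => t'_lt t_lt.
have Ei : i = i'.
  have := congr1 (divn^~ s) E2.
  by rewrite !divnMDl ?divn_small ?addn0 //; lia.
subst i'; split=> //; apply: (@join_idx_inj i) => //; last by lia.
by move: same; case: (odd i); case: (odd j); case: (odd j').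
Qed.

Lemma fu_pos_lt i : i < 2 * h -> fu_pos i < 2 * h.
Proof. by rewrite /fu_pos => i_lt; have := @turn_lt i./2; case: ifP; lia. Qed.

Lemma fu_pos_inj i j : i < 2 * h -> j < 2 * h -> fu_pos i = fu_pos j -> i = j.
Proof.
rewrite /fu_pos => i_lt j_lt.
have := @turn_lt i./2; have := @turn_lt j./2; have := @turn_inj i./2 j./2.
by do 2!case: ifP; lia.
Qed.

Lemma cu_pos_lt i : i < 2 * h -> cu_pos i < 2 * h.
Proof. by rewrite /cu_pos /=; do 2!case: ifP; lia. Qed.

Lemma cu_pos_inj i j : i < 2 * h -> j < 2 * h -> cu_pos i = cu_pos j -> i = j.
Proof. by rewrite /cu_pos /=; do 4!case: ifP; lia. Qed.

Lemma du_pos_lt i : i < 2 * h -> du_pos i < 2 * h.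
Proof. by rewrite /du_pos => i_lt; have := @turn_lt i./2; case: ifP; lia. Qed.

Lemma du_pos_inj i j : i < 2 * h -> j < 2 * h -> du_pos i = du_pos j -> i = j.
Proof.
rewrite /du_pos => i_lt j_lt.
have := @turn_lt i./2; have := @turn_lt j./2; have := @turn_inj i./2 j./2.
by do 2!case: ifP; lia.
Qed.

Lemma fv_pos_lt j : j < 2 * s -> fv_pos j < 2 * s.
Proof. by rewrite /fv_pos; case: ifP; lia. Qed.

Lemma fv_pos_inj i j : i < 2 * s -> j < 2 * s -> fv_pos i = fv_pos j -> i = j.
Proof. by rewrite /fv_pos; do 2!case: ifP; lia. Qed.

Lemma cv_pos_lt j : j < 2 * s -> cv_pos j < 2 * s.
Proof. by rewrite /cv_pos; case: ifP; lia. Qed.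

Lemma cv_pos_inj i j : i < 2 * s -> j < 2 * s -> cv_pos i = cv_pos j -> i = j.
Proof. by rewrite /cv_pos; do 2!case: ifP; lia. Qed.

Lemma dv_pos_lt j : j < 2 * s -> dv_pos j < 2 * s.
Proof. by rewrite /dv_pos; lia. Qed.

Lemma dv_pos_inj i j : i < 2 * s -> j < 2 * s -> dv_pos i = dv_pos j -> i = j.
Proof. by rewrite /dv_pos; lia. Qed.

(** * Row and column sums of the join array *)

Lemma join_pos_even i t : join_pos i (2 * t) =
  if odd i then 4 * h * s - 1 - (i * s + t) else i * s + t.
Proof. by rewrite /join_pos /join_idx !parity; case: (odd i). Qed.

Lemma join_pos_odd i t : join_pos i (2 * t + 1) =
  if odd i then i * s + twist i t else 4 * h * s - 1 - (i * s + twist i t).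
Proof. by rewrite /join_pos /join_idx !parity; case: (odd i). Qed.

Lemma sum_twist i : \sum_(t < s) twist i t = \sum_(t < s) t.
Proof.
apply: sum_ord_inj => [t|t t']; first exact: twist_lt.
exact: twist_inj.
Qed.

Lemma sum_join_row i : i < 2 * h ->
  \sum_(j < 2 * s) join_pos i j + s = s * (4 * h * s).
Proof.
move=> i_lt; rewrite sum_ord_double.
(* A low and a high entry add up to [4 * h * s - 1], up to the twist; terms are kept on the side
   that avoids subtraction. The twists disappear in the sum because they permute the indices. *)
have pair (t : 'I_s) : join_pos i (2 * t) + join_pos i (2 * t + 1) + twist i t + 1
    = 4 * h * s + t.
  rewrite join_pos_even join_pos_odd.
  have t_lt := ltn_ord t; have t'_lt := @twist_lt i t t_lt.
  have : i * s + s <= 2 * h * s by nia.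
  case: ifP => [odd_i|_]; last by lia.
  by rewrite /twist; case: eqP => [i0|_]; [move: odd_i; rewrite i0|lia].
have : \sum_(t < s) (join_pos i (2 * t) + join_pos i (2 * t + 1) + twist i t + 1)
    = \sum_(t < s) (4 * h * s + t) by apply: eq_bigr => t _; apply: pair.
rewrite !big_split /= !sum_nat_const !card_ord sum_twist.
by do 3!move: (\sum_(i < s) _) => ?; lia.
Qed.

Lemma sum_join_col_even t : t < s ->
  \sum_(i < 2 * h) join_pos i (2 * t) + h + h * s = h * (4 * h * s).
Proof.
move=> t_lt; rewrite (sum_ord_double h (join_pos^~ (2 * t))).
under eq_bigr => u _.
  have -> : join_pos (2 * u) (2 * t) + join_pos (2 * u + 1) (2 * t)
      = 4 * h * s - 1 - s.
    rewrite !join_pos_even; have := ltn_ord u.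
    rewrite !parity.
    by nia.
  over.
by rewrite sum_nat_const card_ord; nia.
Qed.

Lemma sum_join_col_odd t : t < s ->
  \sum_(i < 2 * h) join_pos i (2 * t + 1) + h + cnext s t
  = h * (4 * h * s) + h * s + t.
Proof.
move=> t_lt; rewrite (sum_ord_double h (join_pos^~ (2 * t + 1))).
have pair (u : 'I_h) :
    join_pos (2 * u) (2 * t + 1) + join_pos (2 * u + 1) (2 * t + 1)
      + 1 + twist (2 * u) t = 4 * h * s + s + t.
  rewrite !join_pos_odd; have u_lt := ltn_ord u.
  rewrite !parity.
  have -> : twist (2 * u + 1) t = t by rewrite /twist addn1.
  have : (2 * u + 2) * s <= 2 * h * s by rewrite leq_mul2r; lia.
  by have := @twist_lt (2 * u) t t_lt; lia.
(* Only [u = 0] meets the twisted row 0; the other [h - 1] terms equal [t]. *)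
have twists : \sum_(u < h) twist (2 * u) t + t = cnext s t + h * t.
  rewrite addn1 big_ord_recl /= {1}/twist /= (eq_bigr (fun=> t)) //.
  by rewrite sum_nat_const card_ord mulSn; lia.
have : \sum_(u < h) (join_pos (2 * u) (2 * t + 1)
    + join_pos (2 * u + 1) (2 * t + 1) + 1 + twist (2 * u) t)
    = \sum_(u < h) (4 * h * s + s + t) by apply: eq_bigr => u _; apply: pair.
rewrite !big_split /= !sum_nat_const !card_ord; move: twists.
by do 3!move: (\sum_(u < h) _) => ?; lia.
Qed.

(* The color of an [u_i] contains the labels of all the [v_j], and conversely.
   The longer of the two cycles gets the larger vertex labels, so that the
   shorter one has the larger colors. *)
Definition fu_base := if s <= h then 2 + 2 * s else 2.
Definition fv_base := if s <= h then 2 else 2 + 2 * h.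
(** Label 1 is the hub's and the next [2 * h + 2 * s] are those of the cycle and rim vertices; the
    edge blocks follow without gaps. *)
Definition cu_base := 2 + 2 * h + 2 * s.
Definition cv_base := cu_base + 2 * h.
Definition join_base := cv_base + 2 * s.
Definition du_base := join_base + 4 * h * s.
Definition dv_base := du_base + 2 * h.

(** * Local sums along the two even cycles *)

Definition fu i := fu_base + fu_pos i.
Definition cu i := cu_base + cu_pos i.
Definition du i := du_base + du_pos i.
Definition fv j := fv_base + fv_pos j.
Definition cv j := cv_base + cv_pos j.
Definition dv j := dv_base + dv_pos j.
Definition join_lab i j := join_base + join_pos i j.

(** At [t = 0] the edge sum drops by [h] while the sum of the neighboring vertices rises by [h];
    elsewhere the slopes 2 and -2 cancel. *)
Lemma cycle_part_even t : t < h ->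
  cu (2 * t) + cu (cprev (2 * h) (2 * t))
  + (fu (cnext (2 * h) (2 * t)) + fu (cprev (2 * h) (2 * t))) + du (2 * t) + 3
  = 2 * cu_base + du_base + 2 * fu_base + 6 * h.
Proof.
move=> t_lt; rewrite !double_cycle //.
rewrite /cu /fu /du /cu_pos /fu_pos /du_pos !parity /cprev.
by case: (t =P 0) => [->|t_gt0]; do 2!case: ifP; lia.
Qed.

(** The edges jump by [h] at [t = n], where [turn] wraps: the two neighbors' labels minus
    [2 * turn t] drop by [h] exactly there. *)
Lemma cycle_part_odd t : t < h ->
  cu (2 * t + 1) + cu (cprev (2 * h) (2 * t + 1))
  + (fu (cnext (2 * h) (2 * t + 1)) + fu (cprev (2 * h) (2 * t + 1)))
  + du (2 * t + 1) + 2
  = 2 * cu_base + du_base + 2 * fu_base + 4 * h.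
Proof.
move=> t_lt; rewrite !double_cycle //.
rewrite /cu /fu /du /cu_pos /fu_pos /du_pos !parity.
have : cnext h t = if t == 2 * n then 0 else t.+1.
  by rewrite /cnext; congr (if _ then _ else _); lia.
case: ifP => t_max ->; rewrite /turn; first by do !case: ifP; lia.
by case: (ltnP t n) => t_n; do !case: ifP; lia.
Qed.

Lemma rim_part_even t : t < s ->
  cv (2 * t) + cv (cprev (2 * s) (2 * t))
  + (fv (cnext (2 * s) (2 * t)) + fv (cprev (2 * s) (2 * t))) + dv (2 * t) + 3
  = 2 * cv_base + dv_base + 2 * fv_base + 6 * s.
Proof.
move=> t_lt; rewrite !double_cycle //.
rewrite /cv /fv /dv /cv_pos /fv_pos /dv_pos !parity /cprev.
by case: (t =P 0) => [->|t_gt0]; lia.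
Qed.

(** The residue [cnext s t - t] is left uncancelled on purpose: the column sum in [sum_join_col_odd]
    carries its negative. *)
Lemma rim_part_odd t : t < s ->
  cv (2 * t + 1) + cv (cprev (2 * s) (2 * t + 1))
  + (fv (cnext (2 * s) (2 * t + 1)) + fv (cprev (2 * s) (2 * t + 1)))
  + dv (2 * t + 1) + 2 + t
  = 2 * cv_base + dv_base + 2 * fv_base + 4 * s + cnext s t.
Proof.
move=> t_lt; have := cnext_lt t_lt; rewrite !double_cycle //.
by rewrite /cv /fv /dv /cv_pos /fv_pos /dv_pos !parity; lia.
Qed.

(** * The labeling is a bijection *)

Let m_gt2 : 2 < 2 * h. Proof. lia. Qed.
Let k_gt2 : 2 < 2 * s. Proof. lia. Qed.

Let G := join_graph (cycle_graph (2 * h)) (wheel_graph (2 * s)).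
Let g : G -> nat := @vlab (2 * h) (2 * s) fu fv 1.
Let l : G -> G -> nat := @elab (2 * h) (2 * s) cu du cv dv join_lab.

Definition lab (z : G + edge_index (2 * h) (2 * s)) : nat :=
  match z with inl x => g x | inr e => l (ends e).1 (ends e).2 end.

(** Pairs each label with its block: blocks separate the kinds of elements, the formula separates
    elements of one kind. *)
Definition lab_spec (z : G + edge_index (2 * h) (2 * s)) : Prop :=
  match z with
  | inl (inl i) => lab z = fu i /\ fu_base <= lab z < fu_base + 2 * h
  | inl (inr j) =>
    if j < 2 * s then lab z = fv j /\ fv_base <= lab z < fv_base + 2 * s
    else lab z = 1
  | inr (inl (i, j)) =>
    if j < 2 * s then lab z = join_lab i j /\
      join_base <= lab z < join_base + 4 * h * s
    else lab z = du i /\ du_base <= lab z < du_base + 2 * h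
  | inr (inr (inl i)) => lab z = cu i /\ cu_base <= lab z < cu_base + 2 * h
  | inr (inr (inr (inl j))) =>
    lab z = cv j /\ cv_base <= lab z < cv_base + 2 * s
  | inr (inr (inr (inr j))) =>
    lab z = dv j /\ dv_base <= lab z < dv_base + 2 * s
  end.

Lemma labP z : lab_spec z.
Proof.
case: z => [[i|j]|[[i j]|[i|[j|j]]]]; rewrite /lab_spec /lab.
- by rewrite /g /= /fu; have := fu_pos_lt (ltn_ord i); split; lia.
- rewrite /g /=; case: ifP => j_lt; rewrite j_lt //.
  by rewrite /fv; have := fv_pos_lt j_lt; split; lia.
- rewrite /l /= /rung_lab; case: ifP => j_lt; rewrite j_lt.
    by rewrite /join_lab; have := join_pos_lt (ltn_ord i) j_lt; split; lia.
  by rewrite /du; have := du_pos_lt (ltn_ord i); split; lia.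
- rewrite /l /= cycle_lab_next.
  by rewrite /cu; have := cu_pos_lt (ltn_ord i); split; lia.
- have j_lt := ltn_ord j; have nj_lt := cnext_lt j_lt.
  have [jS njS] : j < (2 * s).+1 /\ cnext (2 * s) j < (2 * s).+1 by split; apply: ltnW.
  rewrite /l /= !inordK // !ltn_eqF //.
  by rewrite cycle_lab_next /cv; have := cv_pos_lt j_lt; split; lia.
- have j_lt := ltn_ord j.
  rewrite /l /= eqxx inordK; last exact: ltnW.
  by rewrite /dv; have := dv_pos_lt j_lt; split; lia.
Qed.

Lemma fu_fv_base : [/\ 1 < fu_base, 1 < fv_base, fu_base + 2 * h <= cu_base,
  fv_base + 2 * s <= cu_base &
  fu_base + 2 * h <= fv_base \/ fv_base + 2 * s <= fu_base].
Proof. by rewrite /cu_base /fu_base /fv_base; case: ifP; split; lia. Qed.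

Lemma lab_bounds z : 1 <= lab z <= #|G| + #|{: edge_index (2 * h) (2 * s)}|.
Proof.
rewrite !card_sum card_prod !card_ord; have [? ? ? ? _] := fu_fv_base.
(* One more than order plus size: there are [2 * h + 2 * s + 1] vertices and
   [2 * h * (2 * s + 1) + 2 * h + 4 * s] edges. *)
have dvE : dv_base + 2 * s = 6 * h + 6 * s + 4 * h * s + 2.
  by rewrite /dv_base /du_base /join_base /cv_base /cu_base; lia.
have := labP z.
case: z => [[i|j]|[[i j]|[i|[j|j]]]]; rewrite /lab_spec; try case: ifP => _;
move: (lab _) dvE; rewrite /dv_base /du_base /join_base /cv_base => x; nia.
Qed.

Lemma lab_inj : injective lab.
Proof.
move=> y z E; have [? ? ? ? ?] := fu_fv_base.
have dvE : dv_base = du_base + 2 * h by [].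
have duE : du_base = join_base + 4 * h * s by [].
have joinE : join_base = cv_base + 2 * s by [].
have cvE : cv_base = cu_base + 2 * h by [].
have := labP y; have := labP z.
case: y E => [[i|j]|[[i j]|[i|[j|j]]]] E;
case: z E => [[i'|j']|[[i' j']|[i'|[j'|j']]]] E; rewrite /lab_spec.
(* Elements from different blocks cannot share a label; what remains is injectivity of the
   positions. *)
all: try by repeat case: ifP => _; rewrite -?E; lia.
- move=> [E' _] [E2 _]; congr (inl (inl _)); apply: val_inj.
  by apply: fu_pos_inj => //=; move: E; rewrite E' E2 /fu; lia.
- case: ifP => j'_lt; case: ifP => j_lt; try by rewrite -?E; lia.
    move=> [E' _] [E2 _]; congr (inl (inr _)); apply: val_inj.
    by apply: fv_pos_inj => //=; move: E; rewrite E' E2 /fv; lia.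
  move=> _ _; congr (inl (inr _)); apply: val_inj => /=.
  by have := ltn_ord j; have := ltn_ord j'; lia.
- case: ifP => j'_lt; case: ifP => j_lt; try by rewrite -?E; lia.
    move=> [E' _] [E2 _].
    have [|Ei Ej] := join_pos_inj (ltn_ord i) j_lt (ltn_ord i') j'_lt.
      by move: E; rewrite E' E2 /join_lab; lia.
    by congr (inr (inl (_, _))); apply: val_inj.
  move=> [E' _] [E2 _]; congr (inr (inl (_, _))); apply: val_inj.
    by apply: du_pos_inj => //=; move: E; rewrite E' E2 /du; lia.
  by rewrite /=; have := ltn_ord j; have := ltn_ord j'; lia.
- move=> [E' _] [E2 _]; congr (inr (inr (inl _))); apply: val_inj.
  by apply: cu_pos_inj => //=; move: E; rewrite E' E2 /cu; lia.
- move=> [E' _] [E2 _]; congr (inr (inr (inr (inl _)))); apply: val_inj.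
  by apply: cv_pos_inj => //=; move: E; rewrite E' E2 /cv; lia.
- move=> [E' _] [E2 _]; congr (inr (inr (inr (inr _)))); apply: val_inj.
  by apply: dv_pos_inj => //=; move: E; rewrite E' E2 /dv; lia.
Qed.

(** * The five colors and their order *)

Definition color_u_even :=
  2 * cu_base + du_base + 2 * fu_base + 6 * h
  + s * (4 * h * s) + 2 * s * join_base + \sum_(j < 2 * s) fv j + 1 - (3 + s).
Definition color_u_odd :=
  2 * cu_base + du_base + 2 * fu_base + 4 * h
  + s * (4 * h * s) + 2 * s * join_base + \sum_(j < 2 * s) fv j + 1 - (2 + s).
Definition color_v_even :=
  2 * cv_base + dv_base + 2 * fv_base + 6 * s
  + h * (4 * h * s) + 2 * h * join_base + \sum_(i < 2 * h) fu i + 1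
  - (3 + h + h * s).
Definition color_v_odd :=
  2 * cv_base + dv_base + 2 * fv_base + 4 * s
  + h * (4 * h * s) + h * s + 2 * h * join_base + \sum_(i < 2 * h) fu i + 1
  - (2 + h).
Definition color_hub :=
  \sum_(i < 2 * h) (du i + fu i) + \sum_(j < 2 * s) (dv j + fv j).

Lemma sum_fu : \sum_(i < 2 * h) fu i = 2 * h * fu_base + h * (2 * h - 1).
Proof.
rewrite big_split /= sum_nat_const card_ord -sum_ord_even; congr (_ + _).
by apply: sum_ord_inj => [i|i j]; [apply: fu_pos_lt | apply: fu_pos_inj].
Qed.

Lemma sum_fv : \sum_(j < 2 * s) fv j = 2 * s * fv_base + s * (2 * s - 1).
Proof.
rewrite big_split /= sum_nat_const card_ord -sum_ord_even; congr (_ + _).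
by apply: sum_ord_inj => [i|i j]; [apply: fv_pos_lt | apply: fv_pos_inj].
Qed.

(* The edges at the hub carry the largest labels, so a crude bound suffices. *)
Lemma color_hub_ge : 2 * h * du_base + 2 * s * dv_base +
  \sum_(i < 2 * h) fu i + \sum_(j < 2 * s) fv j <= color_hub.
Proof.
have du_ge : 2 * h * du_base <= \sum_(i < 2 * h) du i.
  rewrite -[X in X * _ <= _](card_ord (2 * h)) -sum_nat_const.
  by apply: leq_sum => i _; apply: leq_addr.
have dv_ge : 2 * s * dv_base <= \sum_(j < 2 * s) dv j.
  rewrite -[X in X * _ <= _](card_ord (2 * s)) -sum_nat_const.
  by apply: leq_sum => i _; apply: leq_addr.
have -> : color_hub = \sum_(i < 2 * h) du i + \sum_(i < 2 * h) fu i +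
    (\sum_(j < 2 * s) dv j + \sum_(j < 2 * s) fv j).
  by rewrite /color_hub -!big_split.
rewrite [leqRHS]addnACA -[leqLHS]addnA.
by rewrite leq_add2r; apply: leq_add.
Qed.

Lemma colors_uniq : uniq
  [:: color_u_even; color_u_odd; color_v_even; color_v_odd; color_hub].
Proof.
have hub_ge := color_hub_ge.
(* The two colors of one cycle lie entirely below the two of the other, and the hub lies above all
   four. *)
suff : [/\ color_u_odd < color_u_even, color_v_even < color_v_odd,
    color_u_even < color_hub, color_v_odd < color_hub &
    color_u_even < color_v_even \/ color_v_odd < color_u_odd].
  move: color_u_even color_u_odd color_v_even color_v_odd color_hub.
  by move=> a b c d e [? ? ? ? ?]; rewrite /= !inE; lia.
move: hub_ge; rewrite /color_u_odd /color_u_even /color_v_odd /color_v_even.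
rewrite sum_fu sum_fv /dv_base /du_base /join_base /cv_base /cu_base.
rewrite /fu_base /fv_base; move: color_hub => hub.
have : 2 < h by lia.
move: (h) => k k_gt.
(* Comparing the monomials beforehand makes the final inequalities linear in them; which cycle has
   the larger colors depends on [s <= h]. *)
have ks_ge : 3 * s <= k * s /\ 2 * k <= k * s by nia.
have sq_ge : 3 * k <= k * k /\ 2 * s <= s * s by nia.
have kss_ge : 2 * (k * s) <= k * s * s by nia.
have kks_ge : 3 * (k * s) <= k * s * k by nia.
case: (leqP s k) => s_k.
  have ss_le : s * s <= k * s /\ k * s <= k * k by nia.
  have kss_le : k * s * s <= k * s * k by nia.
  by move=> hub_ge; split; try left; lia.
have kk_lt : k * k + k <= k * s /\ k * s + s <= s * s by nia.
have kks_lt : k * s * k + k * s <= k * s * s by nia.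
by move=> hub_ge; split; try right; lia.
Qed.

(** * A proper labeling with at most five colors, and the clique *)

Lemma exists_labeling : exists2 f : G + {set G} -> nat,
  is_ltna_labeling f & c_tn f <= 5.
Proof.
have [f [f_total f_vert f_edge]] := total_labeling_of_ends
  (elab_sym cu du cv dv join_lab m_gt2 k_gt2) (@ends_adj _ _ m_gt2 k_gt2)
  (@ends_surj _ _ m_gt2 k_gt2) lab_inj lab_bounds.
have sum_row i : i < 2 * h ->
    \sum_(j < 2 * s) join_lab i j + s = s * (4 * h * s) + 2 * s * join_base.
  move=> i_lt; rewrite big_split /= sum_nat_const card_ord.
  by have := sum_join_row i_lt; move: (bigop _ _ _) => ?; lia.
have sum_col j : \sum_(i < 2 * h) join_lab i j =
    \sum_(i < 2 * h) join_pos i j + 2 * h * join_base.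
  by rewrite big_split /= sum_nat_const card_ord addnC.
have color_u (i : 'I_(2 * h)) :
    tn_color f (inl i) = if odd i then color_u_odd else color_u_even.
  rewrite (tn_color_cycle m_gt2 k_gt2 f_vert f_edge).
  have := sum_row i (ltn_ord i); have i_lt := ltn_ord i.
  have t_lt : i./2 < h by lia.
  rewrite /color_u_odd /color_u_even; case: ifP => odd_i.
    have -> : nat_of_ord i = 2 * i./2 + 1 by lia.
    have := cycle_part_odd t_lt; lia.
  have -> : nat_of_ord i = 2 * i./2 by lia.
  have := cycle_part_even t_lt; lia.
have color_v (j : 'I_(2 * s).+1) : j < 2 * s ->
    tn_color f (inr j) = if odd j then color_v_odd else color_v_even.
  move=> j_lt; rewrite (tn_color_rim m_gt2 k_gt2 f_vert f_edge) //.
  have t_lt : j./2 < s by lia.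
  rewrite sum_col /color_v_odd /color_v_even; case: ifP => odd_j.
    have -> : nat_of_ord j = 2 * j./2 + 1 by lia.
    have := rim_part_odd t_lt; have := sum_join_col_odd t_lt; lia.
  have -> : nat_of_ord j = 2 * j./2 by lia.
  have := rim_part_even t_lt; have := sum_join_col_even t_lt; lia.
have color_h (j : 'I_(2 * s).+1) : j < 2 * s = false ->
    tn_color f (inr j) = color_hub.
  move=> j_ge; have -> : j = ord_max.
    by apply: val_inj => /=; have := ltn_ord j; lia.
  exact: (tn_color_hub f_vert f_edge).
pose q := [:: color_u_even; color_u_odd; color_v_even; color_v_odd; color_hub].
(* A color becomes an index into [q], so that distinctness of colors reduces to distinctness of
   indices. *)
have tnE x : tn_color f x = nth 0 q match x with
    | inl i => odd i
    | inr j => if j < 2 * s then 2 + odd j else 4 end.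
  case: x => [i|j]; first by rewrite color_u; case: (odd i).
  by case: ifP => j_lt; [rewrite color_v //; case: (odd j) | rewrite color_h].
have q_nth a b : a < 5 -> b < 5 -> (nth 0 q a == nth 0 q b) = (a == b).
  by move=> a_lt b_lt; rewrite nth_uniq // colors_uniq.
exists f; last first.
  apply: (@c_tn_le _ _ q) => x; rewrite tnE mem_nth //.
  by case: x => [i|j]; [case: (odd i) | case: ifP; case: (odd j)].
split=> // x y; rewrite !tnE => xy; rewrite q_nth; last 2 first.
- by case: x xy => [i|j] _; [case: (odd i) | case: ifP; case: (odd j)].
- by case: y xy => [i|j] _; [case: (odd i) | case: ifP; case: (odd j)].
(* Neighbors on either cycle have opposite parities, across the closing edge too since both lengths
   are even. *)
case: x y xy => [i|i] [j|j] xy.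
- move: (xy : sadj (s := cycle_graph (2 * h)) i j); rewrite cycle_adjE // !inE.
  by have := ltn_ord i; rewrite /cnext /cprev; do 2!case: ifP; lia.
- by case: ifP; lia.
- by case: ifP; lia.
case: (ltnP i (2 * s)) => i_lt.
  move: (xy : sadj (s := wheel_graph (2 * s)) i j); rewrite rim_adjE // !inE.
  by rewrite /cnext /cprev; do 3!case: ifP; lia.
have iE : i = ord_max by apply: val_inj => /=; have := ltn_ord i; lia.
move: (xy : sadj (s := wheel_graph (2 * s)) i j); rewrite iE hub_adjE => ->.
by lia.
Qed.

(** An edge of the cycle, joined to the triangle of a rim edge and the hub. *)
Lemma exists_K5 : exists2 q : seq G, pairwise (@sadj G) q & size q = 5.
Proof.
have m0 : 0 < 2 * h by lia.
have m1 : 1 < 2 * h by lia.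
have k0 : 0 < 2 * s by lia.
have k1 : 1 < 2 * s by lia.
pose u0 : cycle_graph (2 * h) := Ordinal m0.
pose u1 : cycle_graph (2 * h) := Ordinal m1.
pose v0 : wheel_graph (2 * s) := Ordinal (ltnW k0 : 0 < (2 * s).+1).
pose v1 : wheel_graph (2 * s) := Ordinal (ltnW k1 : 1 < (2 * s).+1).
pose w : wheel_graph (2 * s) := ord_max.
exists [:: inl u0; inl u1; inr v0; inr v1; inr w] => //.
have uu : sadj u0 u1 by rewrite cycle_adjE // !inE /cnext /=; case: ifP; lia.
have vv : sadj v0 v1.
  by rewrite rim_adjE // !inE /cnext /=; case: ifP; lia.
have vw0 : sadj v0 w by rewrite rim_adjE // !inE eqxx.
have vw1 : sadj v1 w by rewrite rim_adjE // !inE eqxx.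
by move: uu vv vw0 vw1 => /= -> -> -> ->.
Qed.

End Construction.

Theorem theorem2p8 (n s : nat) (hn : 1 <= n) (hs : 2 <= s) :
  chi_ltna_is (join_graph (cycle_graph (4 * n + 2)) (wheel_graph (2 * s))) 5.
Proof.
have -> : 4 * n + 2 = 2 * (2 * n + 1) by lia.
set G := join_graph _ _.
have lower (f : G + {set G} -> nat) : is_ltna_labeling f -> 5 <= c_tn f.
  have [q q_clique q_size] := exists_K5 hn hs.
  by move=> f_ltna; have := clique_c_tn f_ltna q_clique; rewrite q_size.
have [f f_ltna f_le] := exists_labeling hn hs.
split=> //; last first.
  by exists f => //; apply/eqP; rewrite eqn_leq f_le lower.
case=> [i|j]; first by exists (inr ord_max).
have m0 : 0 < 2 * (2 * n + 1) by lia.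
by exists (inl (Ordinal m0)).
Qed.
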